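(* For an integer $n\ge1$ let $\Delta^{n-1}:=\{x\in\mathbb{R}^n : x_k\ge0\ (1\le k\le n),\ \sum_{k=1}^n x_k=1\}$, equipped with the standard Euclidean distance. Then for every $\varepsilon>0$ and every $n\ge1$, $$\mathrm{Widim}_\varepsilon\,\Delta^{n-1}\le\lceil(2/\varepsilon)^2\rceil-1 .$$ Therefore it is not the case that $\mathrm{Widim}_\varepsilon\,\Delta^{n-1}\sim \mathrm{const}_\varepsilon\, n$ as $n\to\infty$ with a positive constant $\mathrm{const}_\varepsilon$ depending only on $\varepsilon$.
   Context: For a compact metric space $(X,d)$, a topological space $Y$ and $\varepsilon>0$, a continuous map $f:X\to Y$ is called an $\varepsilon$-embedding if $\mathrm{Diam}\, f^{-1}(y)\le\varepsilon$ for all $y\in Y$ (diameter with respect to $d$). $\mathrm{Widim}_\varepsilon X=\mathrm{Widim}_\varepsilon(X,d)$ is the minimum integer $k\ge 0$ such that there exist a $k$-dimensional polyhedron $P$ (the underlying topological space of a $k$-dimensional simplicial complex) and an $\varepsilon$-embedding $f:X\to P$. $\lceil a\rceil$ denotes the smallest integer $\ge a$. *)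

(* Defs.v *)
From HB Require Import structures.
From mathcomp Require Import all_boot all_order all_algebra finmap ring lra.
From mathcomp Require Import all_classical all_reals all_analysis.

Set Implicit Arguments.
Unset Strict Implicit.
Unset Printing Implicit Defensive.

Import Order.TTheory GRing.Theory Num.Theory.
Import numFieldNormedType.Exports.

Local Open Scope classical_set_scope.
Local Open Scope ring_scope.

(* An abstract simplicial complex on a possibly infinite vertex set; the
   elements of V that lie in no face play no role. *)
Record simplicial_complex (V : choiceType) := SimplicialComplex {
  face : set {fset V} ;
  face_neq0 : forall s, face s -> s != fset0 ;
  face_sub : forall s t : {fset V},
    face s -> (t `<=` s)%fset -> t != fset0 -> face t }.

Definition has_dimension (V : choiceType) (K : simplicial_complex V) (k : nat) :=
  (exists2 s, face K s & #|` s| = k.+1) /\ (forall s, face K s -> (#|` s| <= k.+1)%N).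

(* The underlying space |K|: barycentric coordinates supported in a face. *)
Record polyhedron (R : realType) (V : choiceType) (K : simplicial_complex V) :=
  Polyhedron {
    bary :> V -> R ;
    bary_ge0 : forall v, 0 <= bary v ;
    bary_face : exists s, [/\ face K s, forall v, v \notin s -> bary v = 0
                            & \sum_(v <- s) bary v = 1] }.

Section polyhedron_topology.
Context (R : realType) (V : choiceType) (K : simplicial_complex V).
Local Notation P := (polyhedron R K).

Lemma bary_inj : injective (@bary R V K).
Proof.
move=> [x x0 xK] [y y0 yK] /= xy; subst y.
by rewrite (Prop_irrelevance x0 y0) (Prop_irrelevance xK yK).
Qed.

Definition closed_simplex (s : {fset V}) : set P :=
  [set x | forall v, v \notin s -> x v = 0].

(* The weak (coherent) topology: U is open iff its trace on every closed
   simplex s is relatively open; on a closed simplex, which has finitely many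
   nonzero coordinates, the Euclidean topology is the pointwise one. *)
Definition polyhedron_open (U : set P) : Prop :=
  forall s, face K s -> exists2 W : set {ptws V -> R}, open W &
    U `&` closed_simplex s = (@bary R V K) @^-1` W `&` closed_simplex s.

Lemma polyhedron_openT : polyhedron_open setT.
Proof. by move=> s _; exists setT; [exact: openT|rewrite preimage_setT]. Qed.

Lemma polyhedron_openI : setI_closed polyhedron_open.
Proof.
move=> A B oA oB s Ks; have [W oW AW] := oA s Ks; have [W' oW' BW'] := oB s Ks.
exists (W `&` W'); first exact: openI.
by rewrite preimage_setI setIIl AW BW' -setIIl.
Qed.

Lemma polyhedron_open_bigU (I : Type) (f : I -> set P) :
  (forall i, polyhedron_open (f i)) -> polyhedron_open (\bigcup_i f i).
Proof.
move=> of_ s Ks.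
have /choice[W HW] : forall i, exists W : set {ptws V -> R}, open W /\
    f i `&` closed_simplex s = (@bary R V K) @^-1` W `&` closed_simplex s.
  by move=> i; have [W oW fW] := of_ i s Ks; exists W.
exists (\bigcup_i W i); first by apply: bigcup_open => i _; have [] := HW i.
rewrite preimage_bigcup !setI_bigcupl.
by apply: eq_bigcupr => i _; have [] := HW i.
Qed.

HB.instance Definition _ := gen_eqMixin P.
HB.instance Definition _ := gen_choiceMixin P.
HB.instance Definition _ := isOpenTopological.Build P
  polyhedron_openT polyhedron_openI polyhedron_open_bigU.

Lemma polyhedron_openE (U : set P) : open U = polyhedron_open U.
Proof. by []. Qed.

End polyhedron_topology.

(* The diameter of the empty set is -oo here. *)
Definition diam (R : realType) (X : metricType R) (A : set X) : \bar R :=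
  ereal_sup [set (mdist p.1 p.2)%:E | p in A `*` A].

Definition eps_embedding (R : realType) (X : metricType R) (Y : topologicalType)
    (eps : R) (f : X -> Y) : Prop :=
  continuous f /\ forall y, (diam (f @^-1` [set y]) <= eps%:E)%E.

Definition eps_embeds_in_dim (R : realType) (eps : R) (X : metricType R)
    (k : nat) : Prop :=
  exists (V : choiceType) (K : simplicial_complex V) (f : X -> polyhedron R K),
    has_dimension K k /\ eps_embedding eps f.

(* Extended-real valued, so that it is +oo, and not a default integer, if there
   is no such k; otherwise the infimum is a minimum (Widim_minE). *)
Definition Widim (R : realType) (eps : R) (X : metricType R) : \bar R :=
  ereal_inf [set k%:R%:E | k in eps_embeds_in_dim eps X].

Lemma Widim_minE (R : realType) (eps : R) (X : metricType R) (k : nat) :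
  Widim eps X = k%:R%:E <->
  eps_embeds_in_dim eps X k /\
  forall j, eps_embeds_in_dim eps X j -> (k <= j)%N.
Proof.
have min_inf j : eps_embeds_in_dim eps X j ->
    (forall i, eps_embeds_in_dim eps X i -> (j <= i)%N) ->
    Widim eps X = j%:R%:E.
  move=> Ej jmin; apply/eqP; rewrite eq_le; apply/andP; split.
    by apply: ereal_inf_lbound; exists j.
  by apply: le_ereal_inf_tmp => _ [i /jmin ji <-]; rewrite lee_fin ler_nat.
split=> [Wk|[]]; last exact: min_inf.
have [[j Ej]|noE] := pselect (exists j, eps_embeds_in_dim eps X j); last first.
  have E0 : eps_embeds_in_dim eps X = set0.
    by rewrite -subset0 => i Ei; apply: noE; exists i.
  by move: Wk; rewrite /Widim E0 image_set0 ereal_inf0.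
have exE : exists j, `[< eps_embeds_in_dim eps X j >] by exists j; apply/asboolP.
case: (ex_minnP exE) => m /asboolP Em mmin.
have {}mmin i : eps_embeds_in_dim eps X i -> (m <= i)%N.
  by move=> Ei; apply: mmin; apply/asboolP.
move: Wk; rewrite (min_inf m Em mmin) => -[] /eqP.
by rewrite eqr_nat => /eqP <-.
Qed.

(* stdsimplex R n is the simplex of dimension n - 1 in R^n. *)
Record stdsimplex (R : realType) (n : nat) := StdSimplex {
  stdsimplex_val :> 'rV[R]_n ;
  _ : [forall k, 0 <= stdsimplex_val 0 k] &&
      (\sum_k stdsimplex_val 0 k == 1) }.

HB.instance Definition _ (R : realType) (n : nat) :=
  [isSub for @stdsimplex_val R n].
HB.instance Definition _ (R : realType) (n : nat) :=
  [Choice of stdsimplex R n by <:].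

Definition euclid_dist (R : realType) (n : nat) (x y : 'rV[R]_n) : R :=
  Num.sqrt (\sum_k (x 0 k - y 0 k) ^+ 2).

Section stdsimplex_metric.
Context (R : realType) (n : nat).
Implicit Types x y z : 'rV[R]_n.

Lemma euclid_dist0 x y : euclid_dist x y = 0 <-> x = y.
Proof.
split=> [|->]; last first.
  by rewrite /euclid_dist big1 ?sqrtr0// => k _; rewrite subrr expr0n.
move/eqP; rewrite sqrtr_eq0 => le0; apply/rowP => k.
have /eqP : \sum_k (x 0 k - y 0 k) ^+ 2 = 0.
  by apply/eqP; rewrite eq_le le0 sumr_ge0// => i _; exact: sqr_ge0.
rewrite psumr_eq0; last by move=> i _; exact: sqr_ge0.
move=> /allP/(_ k (mem_index_enum _))/=.
by rewrite sqrf_eq0 subr_eq0 => /eqP.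
Qed.

Lemma euclid_dist_sym x y : euclid_dist x y = euclid_dist y x.
Proof.
by congr Num.sqrt; apply: eq_bigr => k _; rewrite -sqrrN opprB.
Qed.

Lemma cauchy_schwarz (a b : 'I_n -> R) :
  \sum_k a k * b k <=
  Num.sqrt (\sum_k a k ^+ 2) * Num.sqrt (\sum_k b k ^+ 2).
Proof.
set A := \sum_k a k ^+ 2; set B := \sum_k b k ^+ 2; set S := \sum_k _.
have A0 : 0 <= A by apply: sumr_ge0 => k _; exact: sqr_ge0.
have B0 : 0 <= B by apply: sumr_ge0 => k _; exact: sqr_ge0.
have SAB : S ^+ 2 <= A * B.
  have [Bp|] := ltP 0 B; last first.
    move=> Bn; have {Bn} Bz : B = 0 by apply/eqP; rewrite eq_le Bn.
    move/eqP: (Bz); rewrite psumr_eq0; last by move=> i _; exact: sqr_ge0.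
    move=> /allP bz; rewrite Bz mulr0 /S big1 ?expr0n// => k _.
    by have /= := bz k (mem_index_enum _); rewrite sqrf_eq0 => /eqP ->; rewrite mulr0.
  have : 0 <= \sum_k (B * a k - S * b k) ^+ 2.
    by apply: sumr_ge0 => k _; exact: sqr_ge0.
  have -> : \sum_k (B * a k - S * b k) ^+ 2 = B * (A * B - S ^+ 2).
    transitivity (\sum_k (B ^+ 2 * a k ^+ 2 + (- (B * S *+ 2) * (a k * b k) +
        S ^+ 2 * b k ^+ 2))).
      by apply: eq_bigr => k _; ring.
    by rewrite !big_split/= -!mulr_sumr -/A -/B -/S; ring.
  by rewrite pmulr_rge0// subr_ge0.
rewrite -sqrtrM//; apply: (le_trans (ler_norm _)).
by rewrite -sqrtr_sqr ler_wsqrtr.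
Qed.

Lemma euclid_dist_triangle y x z :
  euclid_dist x z <= euclid_dist x y + euclid_dist y z.
Proof.
set d := euclid_dist x y; set e := euclid_dist y z.
have d0 : 0 <= d by exact: sqrtr_ge0.
have e0 : 0 <= e by exact: sqrtr_ge0.
rewrite -[leRHS]ger0_norm ?addr_ge0// -sqrtr_sqr ler_wsqrtr//.
have -> : \sum_k (x 0 k - z 0 k) ^+ 2 = \sum_k ((x 0 k - y 0 k) ^+ 2 +
    ((x 0 k - y 0 k) * (y 0 k - z 0 k) *+ 2 + (y 0 k - z 0 k) ^+ 2)).
  by apply: eq_bigr => k _; rewrite addrA -sqrrD addrA subrK.
have dE : d ^+ 2 = \sum_k (x 0 k - y 0 k) ^+ 2.
  by rewrite sqr_sqrtr// sumr_ge0// => k _; exact: sqr_ge0.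
have eE : e ^+ 2 = \sum_k (y 0 k - z 0 k) ^+ 2.
  by rewrite sqr_sqrtr// sumr_ge0// => k _; exact: sqr_ge0.
have := cauchy_schwarz (fun k => x 0 k - y 0 k) (fun k => y 0 k - z 0 k).
rewrite !big_split/= sqrrD dE eE -/(euclid_dist x y) -/(euclid_dist y z) -/d -/e.
lra.
Qed.

Let sdist (p q : stdsimplex R n) : R := euclid_dist p q.

Let sdistxx p : sdist p p = 0. Proof. exact/euclid_dist0. Qed.

Let sdist_eq0 p q : sdist p q = 0 -> p = q.
Proof. by move/euclid_dist0 => pq; exact: val_inj. Qed.

Let sdist_sym p q : sdist p q = sdist q p.
Proof. exact: euclid_dist_sym. Qed.

Let sdist_triangle q p r : sdist p r <= sdist p q + sdist q r.
Proof. exact: euclid_dist_triangle. Qed.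

HB.instance Definition _ := isMetric.Build R (stdsimplex R n)
  sdistxx sdist_eq0 sdist_sym sdist_triangle.

Lemma stdsimplex_mdistE (p q : stdsimplex R n) :
  mdist p q = Num.sqrt (\sum_k (p 0 k - q 0 k) ^+ 2).
Proof. by []. Qed.

End stdsimplex_metric.

(* Main.v *)
(** Fix [a = 1 / (N + 1)] and send [x] to the vector of truncations
    [max (x_k - a) 0], completed by one more barycentric coordinate that brings
    the total mass to [1].  A point of the simplex has at most [N] coordinates
    exceeding [a], so at most [N + 1] barycentric coordinates are nonzero and the
    image lies in a complex of dimension [N].  Two points [x], [y] of the same
    fibre agree at every coordinate exceeding [a], and at the others
    [(x_k - y_k)^2 <= a (x_k + y_k)]; summing, [|x - y|^2 <= 2 a]. *)
Require Import Defs.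
From mathcomp Require Import all_boot all_order all_algebra finmap lra.
From mathcomp Require Import all_classical all_reals all_analysis.
Import Order.TTheory GRing.Theory Num.Theory.
Import numFieldNormedType.Exports.
Local Open Scope classical_set_scope.
Local Open Scope ring_scope.

(** * Skeleta of a full simplex *)

Section skeleton.
Context (V : choiceType) (N : nat).

Let skeleton_face : set {fset V} := [set s | s != fset0 /\ (#|` s| <= N.+1)%N].

Lemma skeleton_face_neq0 s : skeleton_face s -> s != fset0.
Proof. by case. Qed.

Lemma skeleton_face_sub (s t : {fset V}) :
  skeleton_face s -> (t `<=` s)%fset -> t != fset0 -> skeleton_face t.
Proof.
by move=> [_ sN] ts t0; split=> //; exact: leq_trans (fsubset_leq_card ts) sN.
Qed.

Definition skeleton : simplicial_complex V :=
  SimplicialComplex skeleton_face_neq0 skeleton_face_sub.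

End skeleton.

Lemma skeleton_dimension (N : nat) : has_dimension (skeleton nat N) N.
Proof.
have sN : #|` [fset i in iota 0 N.+1]%fset| = N.+1.
  by rewrite card_fseq undup_id ?iota_uniq// size_iota.
split; last by move=> s [].
exists [fset i in iota 0 N.+1]%fset => //.
by split; [rewrite -cardfs_gt0 sN|rewrite sN].
Qed.

(** * Continuity of maps into a polyhedron *)

Lemma continuous_ptws (X : topologicalType) (V : choiceType) (Y : topologicalType)
    (g : X -> {ptws V -> Y}) :
  (forall v, continuous (fun x => g x v)) -> continuous g.
Proof.
move=> gc x; apply/cvg_sup => v B /= [_ [[W oW <-] Wgxv] WB].
apply: (filterS (P := [set y | W (g y v)])); first by move=> y; exact: WB.
by apply: (gc v x W); exact: open_nbhs_nbhs.
Qed.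

(* In the weak topology, coordinatewise continuity suffices for a map into a
   finite subcomplex: near [x] the finitely many faces missing [f x] are avoided. *)
Lemma continuous_polyhedron (R : realType) (V : choiceType)
    (K : simplicial_complex V) (X : topologicalType) (f : X -> polyhedron R K)
    (D : {fset V}) :
  (forall x v, v \notin D -> f x v = 0) ->
  (forall v, continuous (fun x => f x v)) -> continuous f.
Proof.
move=> fD fc x U /=; rewrite nbhsE => -[B [oB Bfx] BU].
have cf : continuous (fun x => bary (f x) : {ptws V -> R}).
  exact: continuous_ptws.
(* If [f x] lies in the closed simplex [s], the trace of [B] on it is cut out by a pointwise open
   [W], which contains [f y] for [y] near [x]. Otherwise some coordinate outside [s] is nonzero at
   [x], hence also nearby, and [f y] misses the simplex. *)
have near_face s : face K s ->
    \forall y \near x, closed_simplex s (f y) -> B (f y).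
  move=> Ks; have [W oW BW] := oB s Ks.
  have [fxs|/existsNP[v /not_implyP[vs /eqP fxv]]] :=
      pselect (closed_simplex s (f x)).
    have : (B `&` closed_simplex s) (f x) by [].
    rewrite BW => -[/= Wfx _].
    have : \forall y \near x, W (bary (f y)).
      by apply: (cf x W); exact: open_nbhs_nbhs.
    apply: filterS => y Wfy fys.
    by have [] : (B `&` closed_simplex s) (f y) by rewrite BW.
  apply: filterS (cvgr_neq0 _ (fc v x) fxv) => y /eqP fyv.
  by move=> /(_ v vs).
have : \forall y \near x, (\bigcap_(s in [set` fpowerset D])
    [set y | face K s -> closed_simplex s (f y) -> B (f y)]) y.
  apply: filter_bigI => s _.
  have [/near_face|nKs] := pselect (face K s); first by apply: filterS => y + _.
  by apply: filterE => y.
apply: filterS => y By; apply: BU.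
(* The face carrying [f y] is shrunk to its part in [D], one of the finitely many sets treated
   above. This part is nonempty because the coordinates of [f y] sum to 1. *)
have [s [Ks fs s1]] := bary_face (f y).
have sD0 v : v \notin (s `&` D)%fset -> f y v = 0.
  by rewrite inE negb_and => /orP[/fs|/fD].
apply: (By (s `&` D)%fset) => //=; first by rewrite fpowersetE fsubsetIr.
apply: (face_sub Ks); first exact: fsubsetIl.
apply/eqP => sD; have : \sum_(v <- s) f y v = 0.
  by apply: big1 => v _; apply: sD0; rewrite sD inE.
by move/eqP; rewrite s1 oner_eq0.
Qed.

(** * Coordinates on the standard simplex *)

Lemma stdsimplex_ge0 (R : realType) (n : nat) (x : stdsimplex R n) k : 0 <= x 0 k.
Proof. by have /andP[/forallP] := valP x. Qed.

Lemma stdsimplex_sum (R : realType) (n : nat) (x : stdsimplex R n) :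
  \sum_k x 0 k = 1.
Proof. by have /andP[_ /eqP] := valP x. Qed.

(** Coordinates are 1-Lipschitz for the Euclidean distance. *)
Lemma continuous_stdsimplex_coord (R : realType) (n : nat) (k : 'I_n) :
  continuous (fun x : stdsimplex R n => x 0 k).
Proof.
move=> x; apply/(@cvgrPdist_lt _ R^o _ (nbhs x) (nbhs_filter x)) => e e0.
apply/nbhs_ballP; exists e => //= y.
rewrite ballEmdist/= stdsimplex_mdistE; apply: le_lt_trans.
rewrite -sqrtr_sqr ler_wsqrtr// (bigD1 k)//= lerDl.
by apply: sumr_ge0 => i _; exact: sqr_ge0.
Qed.

(** If both truncations vanish, then [u, v <= a], so [(u - v)^2 <= u^2 + v^2 <= a * (u + v)]. If
    both are positive, then [u = v]. The mixed cases are contradictory. *)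
Lemma sqr_sub_le_of_max_sub_eq (R : realDomainType) (a u v : R) :
  0 <= a -> 0 <= u -> 0 <= v -> Num.max (u - a) 0 = Num.max (v - a) 0 ->
  (u - v) ^+ 2 <= a * (u + v).
Proof.
move=> a0 u0 v0; have uv0 : 0 <= u * v by exact: mulr_ge0.
rewrite !maxEle; case: (lerP (u - a) 0) => ua; case: (lerP (v - a) 0) => va uv.
- have uau : 0 <= u * (a - u) by apply: mulr_ge0 => //; lra.
  have vav : 0 <= v * (a - v) by apply: mulr_ge0 => //; lra.
  by nra.
- by lra.
- by lra.
- have -> : u = v by lra.
  by rewrite subrr expr0n/= mulr_ge0// addr_ge0.
Qed.

(** * The truncation map and its fibres *)

Section truncation.
Context (R : realType) (n N : nat).
Implicit Types x y : stdsimplex R n.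
Let a : R := N.+1%:R^-1.

Let a_gt0 : 0 < a. Proof. by rewrite invr_gt0. Qed.

Let cut x (k : 'I_n) : R := Num.max (x 0 k - a) 0.

Let cut_ge0 x k : 0 <= cut x k.
Proof. by rewrite le_max lexx orbT. Qed.

Let cut_le x k : cut x k <= x 0 k.
Proof. by rewrite ge_max stdsimplex_ge0 andbT gerBl ltW. Qed.

Let big_coord x : {set 'I_n} := [set k | a < x 0 k]%SET.

Let cut0 x k : k \notin big_coord x -> cut x k = 0.
Proof. by rewrite inE -leNgt => xa; apply/max_idPr; rewrite subr_le0. Qed.

(** Otherwise at least [N + 1] coordinates exceed [a = 1 / (N + 1)], and their sum exceeds 1. *)
Let card_big_coord x : (#|big_coord x| <= N)%N.
Proof.
rewrite leqNgt; apply/negP => Nx.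
have : \sum_(k in big_coord x) a < \sum_(k in big_coord x) x 0 k.
  apply: ltr_sum => [|k]; last by rewrite inE.
  have /card_gt0P[k kx] : (0 < #|big_coord x|)%N by exact: leq_trans Nx.
  by apply/hasP; exists k => //; rewrite mem_index_enum.
rewrite sumr_const ltNge => /negP; apply.
have le1 : \sum_(k in big_coord x) x 0 k <= 1.
  rewrite -(stdsimplex_sum _ _ x) [leRHS](bigID (mem (big_coord x)))/= lerDl.
  by apply: sumr_ge0 => k _; exact: stdsimplex_ge0.
by apply: (le_trans le1); rewrite -mulr_natl /a ler_pdivlMr// mul1r ler_nat.
Qed.

(* Vertex [0] carries the mass removed by the truncation, vertex [k.+1] the
   truncated [k]-th coordinate. *)
Let trunc_bary x (i : nat) : R :=
  if i is j.+1 then if insub j is Some k then cut x k else 0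
  else 1 - \sum_k cut x k.

Let trunc_baryS x (k : 'I_n) : trunc_bary x k.+1 = cut x k.
Proof. by rewrite /= valK. Qed.

Let trunc_bary_ge0 x i : 0 <= trunc_bary x i.
Proof.
case: i => [|j] /=; last by case: insubP.
by rewrite subr_ge0 -(stdsimplex_sum _ _ x) ler_sum.
Qed.

Let trunc_bary_face x : exists s, [/\ face (skeleton nat N) s,
  forall v, v \notin s -> trunc_bary x v = 0 & \sum_(v <- s) trunc_bary x v = 1].
Proof.
(* Vertex 0 is always included, which makes the face nonempty and accounts for the [+ 1] in the
   bound [N + 1]. *)
pose L := 0%N :: [seq (val k).+1 | k <- enum (big_coord x)].
have uL : uniq L.
  rewrite /= map_inj_uniq ?enum_uniq ?andbT; last by move=> i j [/val_inj].
  by apply/negP => /mapP[].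
exists [fset i in L]%fset; split.
- split; first by apply/fset0Pn; exists 0%N; rewrite !inE.
  by rewrite card_fseq undup_id//= size_map -cardE ltnS.
- move=> [|j]; first by rewrite !inE.
  rewrite /=; case: insubP => // k _ <- kL; apply: cut0.
  apply: contra kL => kx; rewrite inE; apply/predU1P; right.
  by rewrite inE; apply/mapP; exists k; rewrite ?mem_enum.
- have -> : \sum_(v <- [fset i in L]%fset) trunc_bary x v =
      \sum_(v <- L) trunc_bary x v.
    by apply: perm_big; apply: uniq_perm => // v; rewrite !inE.
  rewrite big_cons big_map big_enum.
  rewrite (eq_bigr (cut x)) => [|k _]; last exact: trunc_baryS.
  rewrite [trunc_bary x 0]/trunc_bary.
  suff -> : \sum_k cut x k = \sum_(k in big_coord x) cut x k by rewrite subrK.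
  rewrite (bigID (mem (big_coord x)))/= [X in _ + X]big1 ?addr0// => k.
  exact: cut0.
Qed.

Definition truncation x : polyhedron R (skeleton nat N) :=
  Polyhedron (trunc_bary_ge0 x) (trunc_bary_face x).

Lemma continuous_truncation : continuous truncation.
Proof.
have cc k : continuous (fun x => cut x k).
  move=> x; apply: (@continuous_max _ _ (fun x => x 0 k - a) (fun=> 0)); last exact: cst_continuous.
  by apply: continuousB; [exact: continuous_stdsimplex_coord|exact: cst_continuous].
(* Only the vertices [0, ..., n] ever carry mass. *)
apply: (@continuous_polyhedron _ _ _ _ _ [fset i in iota 0 n.+1]%fset).
  move=> x v; rewrite in_fset [in_mem _ _]mem_iota.
  by case: v => //= j; case: insubP => // k _ <-; rewrite add0n ltnS ltn_ord.
move=> [|j] x /=; last by case: insubP => [k _ _|_]; [exact: cc|exact: cst_continuous].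
apply: continuousB; first exact: cst_continuous.
by apply: (@continuous_big R _ +%R 0); [exact: add_continuous|move=> k _; exact: cc].
Qed.

Let cut_fibre x y k : cut x k = cut y k ->
  (x 0 k - y 0 k) ^+ 2 <= a * (x 0 k + y 0 k).
Proof.
by apply: sqr_sub_le_of_max_sub_eq; rewrite ?stdsimplex_ge0// ltW.
Qed.

Lemma truncation_fibre x y : truncation x = truncation y ->
  mdist x y ^+ 2 <= 2 / N.+1%:R.
Proof.
move=> /(congr1 (@bary _ _ _)) xy.
have {}xy : trunc_bary x = trunc_bary y by [].
rewrite stdsimplex_mdistE sqr_sqrtr; last by apply: sumr_ge0 => k _; exact: sqr_ge0.
apply: (@le_trans _ _ (\sum_k a * (x 0 k + y 0 k))).
  by apply: ler_sum => k _; apply: cut_fibre; rewrite -!trunc_baryS xy.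
by rewrite -mulr_sumr big_split/= !stdsimplex_sum mulrC.
Qed.

End truncation.

(** * Bounds on Widim and its growth in the dimension *)

Lemma stdsimplex_eps_embeds (R : realType) (eps : R) (n N : nat) :
  0 <= eps -> 2 / N.+1%:R <= eps ^+ 2 ->
  eps_embeds_in_dim eps (stdsimplex R n) N.
Proof.
move=> eps0 Neps; exists nat, (skeleton nat N), (truncation R n N).
split; first exact: skeleton_dimension.
split; first exact: continuous_truncation.
move=> y; apply: ge_ereal_sup => _ [[p q] [/= py qy] <-].
rewrite lee_fin -(@ler_pXn2r _ 2)// ?nnegrE ?mdist_ge0//.
by apply: le_trans Neps; apply: truncation_fibre; rewrite py qy.
Qed.

Lemma Widim_ge0 (R : realType) (eps : R) (X : metricType R) : (0 <= Widim eps X)%E.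
Proof. by apply: le_ereal_inf_tmp => _ [k _ <-]; rewrite lee_fin. Qed.

Lemma Widim_stdsimplex_le (R : realType) (eps : R) (n : nat) : 0 < eps ->
  (Widim eps (stdsimplex R n) <= (Num.ceil ((2 / eps) ^+ 2) - 1)%:~R%:E)%E.
Proof.
move=> eps0; have t0 : 0 < (2 / eps) ^+ 2 by rewrite exprn_gt0// divr_gt0.
have := ceil_ge ((2 / eps) ^+ 2).
have : 0 < Num.ceil ((2 / eps) ^+ 2) by rewrite ceil_gt0.
(* The ceiling is positive, so it is some [N + 1]. Then [4 / eps^2 <= N + 1], twice what the
   embedding into dimension [N] requires. *)
case: (Num.ceil _) => [[|N]|] // _; rewrite -pmulrn => le_N.
have -> : Posz N.+1 - 1 = N by rewrite -addn1 PoszD addrK.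
apply: ereal_inf_lbound; exists N => //.
apply: stdsimplex_eps_embeds; first exact: ltW.
rewrite ler_pdivrMr//; move: le_N; rewrite expr_div_n ler_pdivrMr ?exprn_gt0//.
by rewrite mulrC; apply: le_trans; lra.
Qed.

Theorem mainTheorem5 (R : realType) :
  (forall (eps : R) (n : nat), 0 < eps -> (1 <= n)%N ->
     (Widim eps (stdsimplex R n) <= (Num.ceil ((2 / eps) ^+ 2) - 1)%:~R%:E)%E)
  /\
  (forall eps : R, 0 < eps ->
     ~ exists c : R, 0 < c /\
         (Widim eps (stdsimplex R n) * ((c * n%:R)^-1)%:E)%E @[n --> \oo]
           --> 1%:E).
Proof.
split=> [eps n eps0 _|eps eps0 [c [c0 cvg1]]]; first exact: Widim_stdsimplex_le.
set M : R := (Num.ceil ((2 / eps) ^+ 2) - 1)%:~R.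
(* The quotient is at most [M / (c * n)], hence at most 1/2 once [n >= 2 * M / c], so its limit
   cannot be 1. *)
have : (1%:E <= 2^-1%:E :> \bar R)%E.
  apply: cvge_le cvg1; near=> n.
  have n0 : 0 < c * n%:R by rewrite mulr_gt0// ltr0n; near: n; exact: nbhs_infty_gt.
  apply: (@le_trans _ _ (M%:E * ((c * n%:R)^-1)%:E)%E).
    by apply: lee_wpmul2r; [rewrite lee_fin invr_ge0 ltW|exact: Widim_stdsimplex_le].
  rewrite -EFinM lee_fin ler_pdivrMr// mulrA -ler_pdivrMl ?mulr_gt0//.
  by near: n; exact: nbhs_infty_ger.
by rewrite lee_fin; lra.
Unshelve. all: by end_near. Qed.
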